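(* Let $p$ be a prime and let $n\in\mathbb Z^+$. Then $\mathrm{ord}_p(C_p(n,r))=\lfloor(n-1)/(p-1)\rfloor$ for at least $p-n^*\ge2$ values of $r\in\{0,\ldots,p-1\}$, where $n^*=\{-n\}_{p-1}$.
   Context: $\mathbb Z^+=\{1,2,\ldots\}$. For $a\in\mathbb Z$ and a positive integer $m$, $\{a\}_m$ denotes the least nonnegative residue of $a$ modulo $m$. $\mathrm{ord}_p$ is the $p$-adic order. For a prime $p$, $n\in\{0,1,2,\ldots\}$ and $r\in\mathbb Z$, $C_p(n,r)=\sum_{0\le k\le n,\ k\equiv r\,(\mathrm{mod}\ p)}\binom nk(-1)^k$. *)

(* Defs.v *)
From mathcomp Require Import all_boot all_order all_algebra.

Set Implicit Arguments.
Unset Strict Implicit.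
Unset Printing Implicit Defensive.

Import Order.TTheory GRing.Theory Num.Theory.

Local Open Scope ring_scope.

(* {a}_m, for m > 0; [modz] is then already nonnegative, so the absolute value
   only serves to land in nat. *)
Definition residue (a : int) (m : nat) : nat := `|(a %% m%:Z)%Z|%N.

(* None stands for ord_p(0) = +oo, whereas [logn p 0] is 0. *)
Definition ordp (p : nat) (a : int) : option nat :=
  if a == 0 then None else Some (logn p `|a|%N).

Definition Csum (p n : nat) (r : int) : int :=
  \sum_(0 <= k < n.+1 | (k%:Z == r %[mod p%:Z])%Z) 'C(n, k)%:Z * (-1) ^+ k.

(* Main.v *)
(* C_p(n, r) is the coefficient of x^r in (1 - x)^n modulo x^p - 1. Write
   n = q(p - 1) + s with 1 <= s <= p - 1, so that n* = p - 1 - s. Then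
   C_p(n, r) = p^q D(r), where D modulo p is a polynomial function of r of
   degree exactly n*, so D vanishes modulo p for at most n* residues r. For
   q = 0, D(r) is (-1)^r binom(s, r), which modulo p is a binomial polynomial;
   passing from n to n + p - 1 multiplies by (1 - x)^(p-1), which acts as p
   times a convolution of total mass -1 and so preserves the degree. *)

Require Import Defs.
From mathcomp Require Import all_boot all_order all_algebra.
From mathcomp Require Import ring zify.

Set Implicit Arguments.
Unset Strict Implicit.
Unset Printing Implicit Defensive.

Import Order.TTheory GRing.Theory Num.Theory.

Local Open Scope ring_scope.

(** * Coefficient identities for (1 - x)^n modulo x^p - 1 *)

Lemma CsumE (p n : nat) (r : int) :
  Csum p n r = \sum_(0 <= k < n.+1)
    (k%:Z == r %[mod p%:Z])%Z%:R * ('C(n, k)%:Z * (-1) ^+ k).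
Proof.
rewrite /Csum big_mkcond; apply: eq_bigr => k _.
by case: ifP => _; rewrite ?mul1r ?mul0r.
Qed.

Lemma CsumS (p n : nat) (r : int) :
  Csum p n.+1 r = Csum p n r - Csum p n (r - 1).
Proof.
have shift k : (k.+1%:Z == r %[mod p%:Z])%Z = (k%:Z == r - 1 %[mod p%:Z])%Z.
  by rewrite !eqz_mod_dvd; congr (_ %| _)%Z; lia.
have -> : Csum p n r = \sum_(0 <= k < n.+2)
    (k%:Z == r %[mod p%:Z])%Z%:R * ('C(n, k)%:Z * (-1) ^+ k).
  by rewrite big_nat_recr //= bin_small // mul0r mulr0 addr0 CsumE.
rewrite !CsumE big_nat_recl // [in RHS]big_nat_recl // -addrA; congr (_ + _);
  first by rewrite !bin0.
rewrite -sumrB; apply: eq_bigr => k _.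
by rewrite shift binS PoszD exprS; ring.
Qed.

(** Compares coefficients in (1 - x)^(n+m) = (1 - x)^n (1 - x)^m. *)
Lemma Csum_addn (p n m : nat) (r : int) :
  Csum p (n + m) r =
  \sum_(0 <= j < m.+1) 'C(m, j)%:Z * (-1) ^+ j * Csum p n (r - j%:Z).
Proof.
elim: m r => [|m IHm] r.
  by rewrite addn0 big_nat1 bin0 !mul1r subr0.
rewrite addnS CsumS !IHm.
have -> : \sum_(0 <= j < m.+1) 'C(m, j)%:Z * (-1) ^+ j * Csum p n (r - j%:Z) =
    \sum_(0 <= j < m.+2) 'C(m, j)%:Z * (-1) ^+ j * Csum p n (r - j%:Z).
  by rewrite [RHS]big_nat_recr //= bin_small // !mul0r addr0.
rewrite big_nat_recl // [in RHS]big_nat_recl // -addrA; congr (_ + _);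
  first by rewrite !bin0.
rewrite -sumrB; apply: eq_bigr => k _.
have -> : r - 1 - k%:Z = r - k.+1%:Z by lia.
by rewrite binS PoszD exprS; ring.
Qed.

Lemma Csum_period (p n : nat) (r : int) : Csum p n (r - p%:Z) = Csum p n r.
Proof.
apply: eq_bigl => k; rewrite !eqz_mod_dvd.
have -> : k%:Z - (r - p%:Z) = k%:Z - r + p%:Z by ring.
by rewrite rpredDr ?dvdzz.
Qed.

(** Since n > 0, each term is a difference; the sum telescopes around one full period. *)
Lemma sum_Csum (p n : nat) (r : int) : (0 < n)%N ->
  \sum_(0 <= j < p) Csum p n (r - j%:Z) = 0.
Proof.
case: n => // n _; apply: oppr_inj; rewrite oppr0 -sumrN.
under eq_bigr => j _ do rewrite CsumS opprB.
have shift j : r - j%:Z - 1 = r - j.+1%:Z by lia.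
under eq_bigr => j _ do rewrite shift.
by rewrite telescope_sumr // subr0 Csum_period subrr.
Qed.

Lemma sum_signed_bin (m : nat) : (0 < m)%N ->
  \sum_(0 <= j < m.+1) 'C(m, j)%:Z * (-1) ^+ j = 0.
Proof.
move=> m_gt0; transitivity ((1 - 1 : int) ^+ m); last first.
  by rewrite subrr expr0n gtn_eqF.
rewrite exprDn big_mkord; apply: eq_bigr => i _.
by rewrite expr1n mul1r -mulr_natl natz.
Qed.

(** * Reduction modulo p and extraction of the power of p *)

Section PrimeModulus.

Variables (p : nat) (p_pr : prime p).

Lemma intr_Fp_eq0 (z : int) : ((z%:~R : 'F_p) == 0) = (p%:Z %| z)%Z.
Proof. by rewrite (dvdz_pcharf (pchar_Fp p_pr)). Qed.

Lemma natr_Fp_neq0 (k : nat) : (0 < k < p)%N -> (k%:R : 'F_p) != 0.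
Proof.
case/andP=> k_gt0 lt_kp; rewrite -(dvdn_pcharf (pchar_Fp p_pr)).
by rewrite gtnNdvd.
Qed.

Lemma natr_Fp_p : (p%:R : 'F_p) = 0.
Proof. exact: pcharf0 (pchar_Fp p_pr). Qed.

(** Consecutive entries of row p - 1 add up to binom(p, j + 1), which p divides, so the signed
    entries are constant modulo p. *)
Lemma bin_pred_prime (j : nat) : (j < p)%N ->
  exists h : int, 'C(p.-1, j)%:Z * (-1) ^+ j = 1 + p%:Z * h.
Proof.
move=> lt_jp.
suff /dvdzP[h Dh] : (p%:Z %| 'C(p.-1, j)%:Z * (-1) ^+ j - 1)%Z.
  by exists h; rewrite [p%:Z * h]mulrC -Dh addrC subrK.
rewrite -intr_Fp_eq0 rmorphB rmorphM rmorphXn rmorphN rmorph1 /=.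
rewrite subr_eq0; apply/eqP.
elim: j lt_jp => [|j IHj] lt_jp; first by rewrite bin0 mulr1.
have pE : p = p.-1.+1 by rewrite prednK ?prime_gt0.
have C0 : ('C(p.-1, j)%:R : 'F_p) + 'C(p.-1, j.+1)%:R = 0.
  apply/eqP; rewrite -natrD addnC -binS -pE.
  by rewrite -(dvdn_pcharf (pchar_Fp p_pr)) prime_dvd_bin.
rewrite -[RHS](IHj (ltnW lt_jp)) -!pmulrn exprS.
by move/eqP: C0; rewrite addrC addr_eq0 => /eqP ->; ring.
Qed.

(* Modulo p, this takes at r the value binom(r + m, m), which is
   (-1)^r binom(p - 1 - m, r) for 0 <= r < p. *)
Definition bin_poly (m : nat) : {poly 'F_p} :=
  (m`!%:R)^-1 *: \prod_(0 <= i < m) ('X - (- i.+1%:R)%:P).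

Lemma fact_Fp_neq0 (m : nat) : (m < p)%N -> (m`!%:R : 'F_p) != 0.
Proof.
elim: m => [|m IHm] lt_mp; first by rewrite oner_neq0.
by rewrite factS natrM mulf_neq0 ?(@natr_Fp_neq0 m.+1) ?IHm ?(ltnW lt_mp).
Qed.

Lemma size_bin_poly (m : nat) : (m < p)%N -> size (bin_poly m) = m.+1.
Proof.
move=> lt_mp; rewrite size_scale ?invr_neq0 ?fact_Fp_neq0 //.
by rewrite size_prod_XsubC size_iota subn0.
Qed.

Lemma horner_bin_poly (m : nat) (x : 'F_p) :
  (bin_poly m).[x] = (m`!%:R)^-1 * \prod_(0 <= i < m) (x + i.+1%:R).
Proof.
rewrite hornerZ horner_prod; congr (_ * _); apply: eq_bigr => i _.
by rewrite hornerXsubC opprK.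
Qed.

(** Pascal's rule for binom(x + m + 1, m + 1); the bound on m makes (m + 1)! invertible. *)
Lemma bin_poly_diff (m : nat) (x : 'F_p) : (m.+1 < p)%N ->
  (bin_poly m).[x] = (bin_poly m.+1).[x] - (bin_poly m.+1).[x - 1].
Proof.
move=> lt_mp; rewrite !horner_bin_poly.
have -> : \prod_(0 <= i < m.+1) (x - 1 + i.+1%:R) =
          x * \prod_(0 <= i < m) (x + i.+1%:R).
  rewrite big_nat_recl // subrK; congr (_ * _).
  by apply: eq_bigr => i _; rewrite -[i.+2%:R]natr1; ring.
rewrite big_nat_recr //= factS natrM.
by field; rewrite fact_Fp_neq0 1?ltnW // addrC natr1 natr_Fp_neq0.
Qed.

Lemma bin_poly_pred (r : int) :
  (bin_poly p.-1).[r%:~R] = (p%:Z %| r)%Z%:R.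
Proof.
have p_gt0 := prime_gt0 p_pr; have lt_p1p : (p.-1 < p)%N by rewrite prednK.
rewrite horner_bin_poly -intr_Fp_eq0; have [->|r_neq0] := eqVneq.
  rewrite [X in _ * X](_ : _ = (p.-1`!)%:R) ?mulVf ?fact_Fp_neq0 //.
  rewrite fact_prod natr_prod big_add1.
  by apply: eq_bigr => i _; rewrite add0r.
set x : 'F_p := r%:~R in r_neq0 *.
have lt_xp : (x < p)%N by rewrite -[X in (_ < X)%N](Fp_cast p_pr).
have x_gt0 : (0 < x)%N by rewrite lt0n.
(* The factor of index p - x - 1 is x + (p - x), which vanishes in ['F_p]. *)
rewrite (big_cat_nat (n := (p - x).-1)) //=; last by lia.
rewrite [X in _ * (_ * X)]big_ltn; last by lia.
rewrite prednK ?subn_gt0 // natrB ?(ltnW lt_xp) // natr_Zp natr_Fp_p.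
by rewrite sub0r subrr !(mul0r, mulr0).
Qed.

(** For n = 0 both sides are the indicator of p | r; each further factor 1 - x takes a backward
    difference, lowering the degree by one. *)
Lemma Csum_small (n : nat) (r : int) : (n < p)%N ->
  ((Csum p n r)%:~R : 'F_p) = (bin_poly (p.-1 - n)).[r%:~R].
Proof.
elim: n r => [|n IHn] r lt_np.
  rewrite subn0 bin_poly_pred CsumE big_nat1 bin0 expr0 !mulr1.
  by rewrite rmorph_nat eqz_mod_dvd sub0r rpredN.
rewrite CsumS rmorphB /= !IHn 1?ltnW // [in RHS]bin_poly_diff; last by lia.
have -> : (p.-1 - n.+1).+1 = (p.-1 - n)%N by lia.
by rewrite rmorphB.
Qed.

(** The degree is prescribed exactly, not just bounded, so that [P] cannot be zero. *)
Definition has_p_part (n q d : nat) : Prop :=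
  exists (D : int -> int) (P : {poly 'F_p}),
    [/\ size P = d.+1, forall r, Csum p n r = p%:Z ^+ q * D r
      & forall r, ((D r)%:~R : 'F_p) = P.[r%:~R]].

Lemma has_p_part_small (n : nat) : (n < p)%N -> has_p_part n 0 (p.-1 - n).
Proof.
move=> lt_np; exists (Csum p n), (bin_poly (p.-1 - n)); split=> [|r|r].
- by rewrite size_bin_poly //; lia.
- by rewrite mul1r.
- exact: Csum_small.
Qed.

(* (1 - x)^(p-1) = (1 + x + ... + x^(p-1)) + p h(x) with h(1) = -1, and the
   first summand kills (1 - x)^n modulo x^p - 1. *)
Lemma has_p_part_step (n q d : nat) : (0 < n)%N ->
  has_p_part n q d -> has_p_part (n + p.-1) q.+1 d.
Proof.
move=> n_gt0 [D [P [sizeP CD DP]]].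
have p_gt1 := prime_gt1 p_pr; have p1S : p.-1.+1 = p by lia.
have p_neq0 : p%:Z != 0 by lia.
pose h (j : nat) := (('C(p.-1, j)%:Z * (-1) ^+ j - 1) %/ p%:Z)%Z.
have hE j : (j < p)%N -> 'C(p.-1, j)%:Z * (-1) ^+ j = 1 + p%:Z * h j.
  by case/bin_pred_prime=> k Dk; rewrite /h Dk addrAC subrr add0r mulKz.
(* Summing [hE] over j gives 0 = p + p * (sum of [h]). *)
have sum_h : \sum_(0 <= j < p) h j = -1.
  have := @sum_signed_bin p.-1; rewrite p1S => /(_ ltac:(lia)).
  rewrite (eq_big_nat _ _ (F2 := fun j => 1 + p%:Z * h j)); last first.
    by move=> j /andP[_ /hE].
  rewrite big_split /= -mulr_sumr big_const_nat subn0 iter_addr_0 natz.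
  move=> eq0; apply: (mulfI p_neq0); rewrite mulrN1.
  by apply/eqP; rewrite -addr_eq0 addrC eq0.
exists (fun r => \sum_(0 <= j < p) h j * D (r - j%:Z)).
exists (\sum_(0 <= j < p) (h j)%:~R *: (P \Po ('X - j%:R%:P))).
have size_sh (c : 'F_p) : size (P \Po ('X - c%:P)) = d.+1.
  by rewrite size_comp_poly2 ?size_XsubC.
split=> [|r|r].
- apply/eqP; rewrite eqn_leq; apply/andP; split.
    apply: (leq_trans (size_sum _ _ _)); apply/bigmax_leqP_seq => j _ _.
    by rewrite (leq_trans (size_scale_leq _ _)) ?size_sh.
  (* Shifting the variable keeps the leading coefficient, so the coefficient of degree [d] is that
     of [P] times the total mass -1. *)
  suff : (\sum_(0 <= j < p) (h j)%:~R *: (P \Po ('X - j%:R%:P)))`_d != 0.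
    by apply: contraNltn => le_d; rewrite nth_default.
  rewrite coef_sum.
  under eq_bigr => j _.
    rewrite coefZ.
    have -> : (P \Po ('X - j%:R%:P))`_d = lead_coef P.
      rewrite -[RHS]mulr1 -[X in _ = _ * X](expr1n _ (size P).-1).
      rewrite -{2}(lead_coefXsubC (j%:R : 'F_p)) -lead_coef_comp ?size_XsubC //.
      by rewrite lead_coefE size_sh.
    over.
  rewrite -mulr_suml -(rmorph_sum intr) /= sum_h mulN1r oppr_eq0.
  by rewrite lead_coef_eq0 -size_poly_eq0 sizeP.
- rewrite Csum_addn p1S.
  rewrite (eq_big_nat _ _ (F2 := fun j => Csum p n (r - j%:Z) +
              p%:Z ^+ q.+1 * (h j * D (r - j%:Z)))); last first.
    by move=> j /andP[_ /hE ->]; rewrite mulrDl mul1r exprS CD; ring.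
  by rewrite big_split /= sum_Csum // add0r mulr_sumr.
- rewrite rmorph_sum horner_sum; apply: eq_bigr => j _.
  by rewrite rmorphM /= DP hornerZ horner_comp hornerXsubC rmorphB.
Qed.

(** Starting from s > 0 keeps the exponent positive, as each step requires. *)
Lemma has_p_part_all (q s : nat) : (0 < s < p)%N ->
  has_p_part (q * p.-1 + s) q (p.-1 - s).
Proof.
case/andP=> s_gt0 lt_sp; elim: q => [|q IHq]; first exact: has_p_part_small.
rewrite mulSn -addnA addnC; apply: has_p_part_step IHq.
by rewrite addn_gt0 s_gt0 orbT.
Qed.

(** * Counting the residues where the order is exact *)

Lemma ordp_expM (q : nat) (z : int) : ~~ (p%:Z %| z)%Z ->
  ordp p (p%:Z ^+ q * z) = Some q.
Proof.
move=> pNz; have p_gt0 := prime_gt0 p_pr.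
have z_neq0 : z != 0 by apply: contraNneq pNz => ->; rewrite dvdz0.
rewrite /ordp mulf_eq0 expf_eq0 (negPf z_neq0) orbF.
have -> : (p%:Z == 0) = false by lia.
rewrite andbF abszM abszX lognM ?expn_gt0 ?p_gt0 ?absz_gt0 //.
rewrite dvdzE in pNz.
by rewrite pfactorK // lognE p_pr (negPf pNz) andbF addn0.
Qed.

(** The order is [q] wherever [P] does not vanish, and [P] has at most [d] roots among the p
    distinct residues. *)
Lemma has_p_part_card (n q d : nat) : has_p_part n q d ->
  (p - d <= #|[set r : 'I_p | ordp p (Csum p n (r : nat)%:Z) == Some q]|)%N.
Proof.
move=> [D [P [sizeP CD DP]]].
pose f (r : 'I_p) : 'F_p := (r : nat)%:R.
have f_inj : injective f.
  move=> a b /(congr1 (fun x : 'F_p => x : nat)).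
  by rewrite /f !val_Fp_nat // !modn_small ?ltn_ord // => /val_inj.
pose A := [set r : 'I_p | root P (f r)].
have cardA : (#|A| <= d)%N.
  rewrite -ltnS -sizeP cardE -(size_map f).
  apply: max_poly_roots; first by rewrite -size_poly_eq0 sizeP.
  - by apply/allP=> x /mapP[r rA ->]; rewrite mem_enum inE in rA.
  - by rewrite map_inj_uniq ?enum_uniq.
apply: (@leq_trans #|~: A|); first by rewrite cardsCs setCK card_ord leq_sub2l.
apply/subset_leq_card/subsetP=> r; rewrite !inE => rootNr.
rewrite CD ordp_expM // -intr_Fp_eq0 DP; exact: rootNr.
Qed.

End PrimeModulus.

Theorem corollary1p3 (p n : nat) (hp : prime p) (hn : (0 < n)%N) :
  let nstar := residue (- n%:Z) (p - 1)%N in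
  (p - nstar >= 2)%N /\
  (#|[set r : 'I_p | ordp p (Csum p n (r : nat)%:Z)
                     == Some ((n - 1) %/ (p - 1))%N]| >= p - nstar)%N.
Proof.
move=> nstar; have p_gt1 := prime_gt1 hp.
(* Dividing n - 1 rather than n puts [s] in 1..p-1 instead of 0..p-2. *)
set q := ((n - 1) %/ (p - 1))%N; pose s := ((n - 1) %% (p - 1)).+1.
have lt_sp : (s < p)%N.
  have : ((n - 1) %% (p - 1) < p - 1)%N by rewrite ltn_mod; lia.
  by rewrite /s; lia.
have nE : n = (q * p.-1 + s)%N.
  by have := divn_eq (n - 1) (p - 1); rewrite -/q /s -subn1; lia.
have nstarE : nstar = (p.-1 - s)%N.
  rewrite /nstar /residue.
  (* The last term lies in 0..p-2, so it is the least residue of -n. *)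
  have -> : - n%:Z = (- q.+1%:Z) * (p - 1)%N%:Z + (p.-1 - s)%N%:Z.
    by rewrite nE -subn1 in lt_sp *; nia.
  by rewrite modzMDl modz_small //; rewrite /s; lia.
rewrite nstarE; split; first by rewrite /s; lia.
apply: has_p_part_card => //; rewrite {1}nE.
by apply: has_p_part_all; rewrite // lt_sp.
Qed.
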